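(* Let $\varphi$ be an $N$-function and let $\sigma$ be a sigmoidal function such that $\phi_\sigma$ has compact support contained in $[-\Upsilon,\Upsilon]$, with $\Upsilon>0$. Then, for every $f\in W^{1,\varphi}(I)$, $$\|K_nf-f\|_\varphi\le 4(1+\Upsilon)\,\frac{\|f'\|_\varphi}{n}$$ for every $n\in\mathbb N$.
   Context: Let $I=[a,b]\subset\mathbb R$ with $a<b$. Sigmoidal functions. A measurable $\sigma:\mathbb R\to\mathbb R$ is sigmoidal if $\lim_{x\to-\infty}\sigma(x)=0$ and $\lim_{x\to+\infty}\sigma(x)=1$. Here every sigmoidal function is assumed non-decreasing, with $\sigma(1)<1$, and to satisfy: (S1) $\sigma(x)-1/2$ is an odd function; (S2) $\sigma\in C^2(\mathbb R)$ is concave for $x\ge 0$; (S3) $\sigma(x)=\mathcal O(|x|^{-\alpha-1})$ as $x\to-\infty$ for some $\alpha>0$. The density function is $\phi_\sigma(x):=\frac12[\sigma(x+1)-\sigma(x-1)]$, $x\in\mathbb R$. Operators. For $f:I\to\mathbb R$ locally integrable and $n\in\mathbb N$ with $\lceil na\rceil\le\lfloor nb\rfloor-1$ (this is assumed of every $n$ considered), $$(K_nf)(x)=\frac{\sum_{k=\lceil na\rceil}^{\lfloor nb\rfloor-1}\left[n\int_{k/n}^{(k+1)/n}f(u)\,du\right]\phi_\sigma(nx-k)}{\sum_{k=\lceil na\rceil}^{\lfloor nb\rfloor-1}\phi_\sigma(nx-k)},\quad x\in I.$$ Orlicz spaces. A $\varphi$-function is a continuous non-decreasing $\varphi:[0,\infty)\to[0,\infty)$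 with $\varphi(0)=0$, $\varphi(u)>0$ for $u>0$, $\lim_{u\to\infty}\varphi(u)=+\infty$. An $N$-function is a convex $\varphi$-function with $\varphi(u)/u\to0$ as $u\to0^+$ and $\varphi(u)/u\to+\infty$ as $u\to+\infty$. For measurable $f$ on $I$, $I^\varphi[f]:=\int_I\varphi(|f(x)|)\,dx$; $L^\varphi(I)$ is the set of measurable $f$ on $I$ with $I^\varphi[\lambda f]<+\infty$ for some $\lambda>0$. The Luxemburg norm is $\|f\|_\varphi:=\inf\{u>0: I^\varphi[f/u]\le1\}$. The Sobolev-Orlicz space is $W^{1,\varphi}(I):=\{f\in AC(I): f'\in L^\varphi(I)\}$, where $AC(I)$ is the space of absolutely continuous functions $I\to\mathbb R$. *)

(* Defs.v *)
From HB Require Import structures.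
From mathcomp Require Import all_boot all_order all_algebra.
From mathcomp Require Import all_classical all_reals all_analysis.
Import Order.TTheory GRing.Theory Num.Theory.
Import numFieldNormedType.Exports.

Set Implicit Arguments.
Unset Strict Implicit.
Unset Printing Implicit Defensive.

Local Open Scope classical_set_scope.
Local Open Scope ring_scope.

Definition C2_fun (R : realType) (g : R -> R) : Prop :=
  [/\ forall x, derivable g x 1, forall x, derivable g^`()%classic x 1
    & continuous (g^`(2))%classic].

Definition concave_function (R : realType) (D : set R) (g : R -> R) : Prop :=
  @convex_function R R^o D (fun x => - g x).

Definition sigmoidal (R : realType) (sigma : R -> R) : Prop :=
  [/\ measurable_fun setT sigma,
      sigma x @[x --> -oo] --> (0 : R)
    & sigma x @[x --> +oo] --> (1 : R)].

Canonical ninfty_filter_on (R : numFieldType) : filter_on R :=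
  FilterType (ninfty_nbhs R) _.

Record admissible_sigmoidal (R : realType) (sigma : R -> R) : Prop := {
  as_sigmoidal : sigmoidal sigma;
  as_nondecreasing : {homo sigma : x y / x <= y};
  as_lt1 : sigma 1 < 1;
  as_odd : forall x, sigma (- x) - 2^-1 = - (sigma x - 2^-1);
  as_C2 : C2_fun sigma;
  as_concave : concave_function `[0, +oo[ sigma;
  as_decay : exists2 alpha : R, 0 < alpha &
    sigma =O_ (-oo_ R) (fun x => `|x| `^ (- alpha - 1)) }.

Definition density (R : realType) (sigma : R -> R) (x : R) : R :=
  2^-1 * (sigma (x + 1) - sigma (x - 1)).

Definition closed_support (R : realType) (g : R -> R) : set R :=
  closure [set x | g x != 0].

(* The range of summation [ceil (n a), floor (n b) - 1]; it is a finite set of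
   integers, so the sums \sum_(k \in _) over it are ordinary finite sums. *)
Definition node_range (R : realType) (a b : R) (n : nat) : set int :=
  [set k | Num.ceil (n%:R * a) <= k <= Num.floor (n%:R * b) - 1].

Definition kantorovich (R : realType) (sigma : R -> R) (a b : R) (n : nat)
    (f : R -> R) (x : R) : R :=
  (\sum_(k \in node_range a b n)
     (n%:R * \int[lebesgue_measure]_(u in `[k%:~R / n%:R, (k + 1)%:~R / n%:R]) f u)
     * density sigma (n%:R * x - k%:~R))
  / (\sum_(k \in node_range a b n) density sigma (n%:R * x - k%:~R)).

(* Only the restriction of phi to [0, +oo[ matters in what follows. *)
Record phi_function (R : realType) (phi : R -> R) : Prop := {
  phi_continuous : {within `[0, +oo[, continuous phi};
  phi_nondecreasing : {in `[0, +oo[ &, {homo phi : u v / u <= v}};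
  phi_at0 : phi 0 = 0;
  phi_gt0 : forall u, 0 < u -> 0 < phi u;
  phi_cvgy : phi u @[u --> +oo] --> +oo }.

Record N_function (R : realType) (phi : R -> R) : Prop := {
  N_phi_function : phi_function phi;
  N_convex : @convex_function R R^o `[0, +oo[ phi;
  N_cvg0 : phi u / u @[u --> 0^'+] --> (0 : R);
  N_cvgy : phi u / u @[u --> +oo] --> +oo }.

Definition modular (R : realType) (phi : R -> R) (a b : R) (g : R -> R) : \bar R :=
  (\int[lebesgue_measure]_(x in `[a, b]) (phi `|g x|)%:E)%E.

Definition orlicz (R : realType) (phi : R -> R) (a b : R) : set (R -> R) :=
  [set g | measurable_fun `[a, b] g /\
    exists2 lambda : R, 0 < lambda &
      (modular phi a b (fun x => (lambda * g x)%R) < +oo)%E].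

(* Extended-real valued, so that the infimum of the empty set is +oo. *)
Definition luxemburg (R : realType) (phi : R -> R) (a b : R) (g : R -> R) : \bar R :=
  ereal_inf [set u%:E | u in
    [set u : R | 0 < u /\ (modular phi a b (fun x => (g x / u)%R) <= 1)%E]].

Definition abs_continuous (R : realType) (a b : R) : set (R -> R) :=
  [set f | forall e : R, 0 < e -> exists2 d : R, 0 < d &
    forall (m : nat) (s t : nat -> R),
      (forall i, (i < m)%N -> a <= s i /\ s i <= t i /\ t i <= b) ->
      trivIset `I_m (fun i => `]s i, t i[%classic) ->
      \sum_(i < m) (t i - s i) < d ->
      \sum_(i < m) `|f (t i) - f (s i)| < e].

(* A function on [a, b] is given by any function on R extending it. An
   absolutely continuous f is differentiable almost everywhere in ]a, b[, where
   f^`() is its derivative whatever the extension is; f^`() is 0 at the points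
   of ]a, b[ where f is not differentiable. *)
Definition sobolev_orlicz (R : realType) (phi : R -> R) (a b : R) : set (R -> R) :=
  [set f | abs_continuous a b f /\ orlicz phi a b f^`()%classic].

(* Main.v *)
From HB Require Import structures.
Require Import Defs.
From mathcomp Require Import all_boot all_order all_algebra.
From mathcomp Require Import all_classical all_reals all_analysis.
From mathcomp Require Import measurable_realfun.
From mathcomp Require Import ring lra zify.
Import Order.TTheory GRing.Theory Num.Theory.
Import numFieldNormedType.Exports.

(** The error of the operator is a local average of f', and averaging does not
    increase a convex modular.

    At x in [a, b] the operator is a mean of the cell averages of f with the
    nonnegative weights [density sigma (n x - k)]. A cell with nonzero weight
    lies within r = (1 + Upsilon) / n of x, so the error at x is at most the
    oscillation of f on [x - r, x + r], hence at most the integral of |f'| over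
    that window ([kantorovich_pointwise]). The weights have a positive sum
    because [density sigma] is positive on [-2, 2]: were it to vanish there,
    concavity would keep sigma below sigma 1 < 1 for ever ([density_gt0]).

    Dividing by 2 r turns the integral over the window into an average. Jensen's
    inequality moves phi inside the average, and integrating the average of a
    nonnegative function over all windows returns the integral of that function,
    by Tonelli ([jensen_N_function], [integral_window]). Therefore
    I[(K f - f) / (2 r u)] <= I[f' / u] for every u > 0 ([modular_le_window]),
    which gives the bound 2 r ||f'|| = 2 (1 + Upsilon) ||f'|| / n, stronger than
    the claimed one by a factor 2.

    What remains is that an absolutely continuous f is the integral of its
    pointwise derivative ([ac_fundamental_theorem]). On the line, f is a
    difference of two nondecreasing absolutely continuous functions, built from
    its total variation ([ac_line_nondecreasing_sub]). The Stieltjes measure of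
    such a function G charges no Lebesgue-null set: a null set sits in an open
    set of small measure, which is a disjoint union of intervals, and absolute
    continuity bounds the sum of the increments of G over them
    ([stieltjes_dominated]). The Radon-Nikodym density of this measure then
    represents G as an integral, and Lebesgue's differentiation theorem
    identifies the density with the derivative almost everywhere. *)

Local Open Scope classical_set_scope.
Local Open Scope ring_scope.
Set Implicit Arguments.
Unset Strict Implicit.
Unset Printing Implicit Defensive.

(** * Total variation over families of intervals *)

Section NonoverlappingFamilies.
Context {R : realType}.
Implicit Types (p q : R * R) (l : seq (R * R)) (F : R -> R) (a b : R).

Definition itv_sep p q := (p.2 <= q.1) || (q.2 <= p.1).

(** Absolute continuity is phrased with lists of closed intervals, compared
    pairwise whatever their order: an interval of a family can then be replaced
    by the pieces of a subdivision, or all intervals be mapped by a monotone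
    function, with no reindexing. *)
Definition nonoverlapping l :=
  all (fun p => p.1 <= p.2) l && pairwise itv_sep l.

Definition total_length l := \sum_(p <- l) (p.2 - p.1).

Definition total_increment F l := \sum_(p <- l) `|F p.2 - F p.1|.

Lemma itv_sepC p q : itv_sep p q = itv_sep q p.
Proof. by rewrite /itv_sep orbC. Qed.

Lemma itv_sep_sub p q r : p.1 <= q.1 -> q.2 <= p.2 -> itv_sep p r -> itv_sep q r.
Proof. by rewrite /itv_sep => h1 h2 /orP[h|h]; apply/orP; [left|right]; lra. Qed.

Lemma nonoverlapping_cat l1 l2 : nonoverlapping (l1 ++ l2) =
  [&& nonoverlapping l1, nonoverlapping l2 & allrel itv_sep l1 l2].
Proof.
rewrite /nonoverlapping all_cat pairwise_cat.
by case: all; case: all; case: allrel; case: pairwise; case: pairwise.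
Qed.

Lemma nonoverlapping_consecutive a b s : path <=%O a s -> last a s = b ->
  [/\ all (fun p => (a <= p.1) && (p.2 <= b)) (zip (a :: s) s),
      nonoverlapping (zip (a :: s) s) &
      total_length (zip (a :: s) s) = b - a].
Proof.
elim: s a => [|h t ih] a /=.
  by move=> _ <-; split; rewrite ?/total_length ?big_nil ?subrr.
move=> /andP[ah pth] lb; have [h1 /andP[h2 h3] h4] := ih _ pth lb.
have hb : h <= b.
  have /allP ht : all (>= h) t := order_path_min le_trans pth.
  by have := mem_last h t; rewrite lb inE => /predU1P[->//|/ht].
split => /=.
- rewrite lexx hb/=; apply: sub_all h1 => p /andP[hp ->].
  by rewrite (le_trans ah).
- rewrite /nonoverlapping/= ah h2 h3 !andbT /=.
  by apply: sub_all h1 => p /andP[hp _]; rewrite /itv_sep/= hp.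
- rewrite /total_length in h4 *; rewrite big_cons h4 /=; lra.
Qed.

Lemma variationE a b F s : itv_partition a b s ->
  variation a b F s = total_increment F (zip (a :: s) s).
Proof.
move=> abs; rewrite (variation_zip _ abs) /total_increment.
by elim: s a {abs} => [|h t ih] a /=; rewrite ?big_nil// !big_cons ih.
Qed.

Local Open Scope ereal_scope.

(** The variation of F on an interval is a supremum over its subdivisions, so
    refining the intervals of [l2] one after the other, and keeping those already
    refined in [l1], transfers a bound from increments to variations. Refining
    changes neither the total length nor the absence of overlaps, hence the same
    [d] and [e] serve throughout the induction. *)
Lemma total_variation_family F (d e : R) :
  (forall l, nonoverlapping l -> (total_length l < d)%R ->
     (total_increment F l <= e)%R) ->
  forall l2 l1, nonoverlapping (l1 ++ l2) -> (total_length (l1 ++ l2) < d)%R ->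
  (total_increment F l1)%:E + \sum_(p <- l2) total_variation p.1 p.2 F <= e%:E.
Proof.
move=> H; elim=> [l1|p l2 ih l1].
  by rewrite cats0 big_nil adde0 lee_fin; exact: H.
rewrite nonoverlapping_cat => /and3P[n1 n2 n12] len.
have := n2; rewrite -cat1s nonoverlapping_cat => /and3P[np n2' np2].
have p12 : (p.1 <= p.2)%R by case/andP: np => /andP[].
have tv0 q : q \in l2 -> 0 <= total_variation q.1 q.2 F.
  by case/andP: n2' => /allP n2' _ /n2' ?; rewrite total_variation_ge0.
have S2fin : \sum_(q <- l2) total_variation q.1 q.2 F \is a fin_num.
  rewrite ge0_fin_numE; last by rewrite big_seq sume_ge0.
  have := ih [::] n2'; rewrite /total_increment big_nil add0e => /(_ _)/le_lt_trans.
  apply; last by rewrite ltry.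
  apply: le_lt_trans len; rewrite /= /total_length big_cat /= big_cons addrA lerDr.
  rewrite addr_ge0 ?subr_ge0// big_seq sumr_ge0// => q ql.
  by rewrite subr_ge0; case/andP: n1 => /allP/(_ _ ql).
rewrite big_cons addeCA -leeBrDr; last by rewrite fin_numD S2fin.
rewrite /total_variation; apply: ge_ereal_sup => _ /= [_ [s ps <-] <-].
rewrite (variationE _ ps) leeBrDr; last by rewrite fin_numD S2fin.
have [ps1 /eqP ps2] := ps.
have [c1 c2 c3] := nonoverlapping_consecutive (sub_path (@ltW _ _) ps1) ps2.
rewrite addeA -EFinD.
have -> : (total_increment F (zip (p.1 :: s) s) + total_increment F l1 =
   total_increment F (zip (p.1 :: s) s ++ l1))%R.
  by rewrite /total_increment big_cat.
apply: ih.
  rewrite nonoverlapping_cat n2' nonoverlapping_cat c2 n1 /=; apply/andP; split.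
    apply/allrelP => x y /(allP c1)/andP[x1 x2] yl.
    apply: (itv_sep_sub x1 x2); rewrite itv_sepC.
    by move/allrelP: n12; apply => //; rewrite mem_head.
  rewrite allrel_catl; apply/andP; split.
    apply/allrelP => x y /(allP c1)/andP[x1 x2] yl.
    apply: (itv_sep_sub x1 x2).
    by move/allrelP: np2; apply => //; rewrite mem_head.
  by apply/allrelP => x y xl yl; move/allrelP: n12; apply => //; rewrite inE yl orbT.
move: len; rewrite /total_length !big_cat/= big_cons => len.
by move: c3; rewrite /total_length => ->; apply: le_lt_trans len; lra.
Qed.

End NonoverlappingFamilies.

(** * Absolute continuity on the line *)

Section AbsolutelyContinuousOnTheLine.
Context {R : realType}.
Implicit Types (F h : R -> R) (l : seq (R * R)) (a b x y : R).

(** Absolutely continuous functions on [a, b] are studied through their constant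
    extension [f \o clamp a b], which has this global property; there are then
    no endpoints to treat apart. *)
Definition ac_line F := forall e : R, 0 < e -> exists2 d : R, 0 < d &
  forall l, nonoverlapping l -> total_length l < d -> total_increment F l <= e.

Lemma nonoverlapping_map h l : {homo h : x y / x <= y} ->
  nonoverlapping l -> nonoverlapping [seq (h p.1, h p.2) | p <- l].
Proof.
move=> hh /andP[l1 l2]; apply/andP; split.
  by rewrite all_map; apply: sub_all l1 => p /= /hh.
rewrite pairwise_map; apply: sub_pairwise l2 => p q /=.
by rewrite /itv_sep/= => /orP[/hh ->//|/hh ->]; rewrite orbT.
Qed.

Lemma total_increment_map F h l :
  total_increment F [seq (h p.1, h p.2) | p <- l] = total_increment (F \o h) l.
Proof. by rewrite /total_increment big_map. Qed.

Definition clamp a b x := Num.max a (Num.min b x).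

Lemma clamp_homo a b : {homo clamp a b : x y / x <= y}.
Proof. by move=> x y xy; rewrite /clamp; apply: le_max2 => //; apply: le_min2. Qed.

Lemma clamp_ge a b x : a <= clamp a b x.
Proof. by rewrite /clamp le_max lexx. Qed.

Lemma clamp_le a b x : a <= b -> clamp a b x <= b.
Proof. by move=> ab; rewrite /clamp ge_max ab ge_min lexx. Qed.

Lemma clamp_id a b x : a <= x <= b -> clamp a b x = x.
Proof. by move=> /andP[ax xb]; rewrite /clamp (min_r xb) (max_r ax). Qed.

Lemma clamp_contract a b x y : x <= y -> clamp a b y - clamp a b x <= y - x.
Proof.
move=> xy; rewrite /clamp; case: (leP b x) => bx; case: (leP b y) => yb.
- lra.
- lra.
- by case: (leP a b) => ?; case: (leP a x) => ?; lra.
- by case: (leP a y) => ?; case: (leP a x) => ?; lra.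
Qed.

Lemma total_length_clamp a b l : nonoverlapping l ->
  total_length [seq (clamp a b p.1, clamp a b p.2) | p <- l] <= total_length l.
Proof.
move=> /andP[/allP l1 _]; rewrite /total_length big_map big_seq [leRHS]big_seq.
by apply: ler_sum => p /l1 p12; exact: clamp_contract.
Qed.

(** Clamping is nondecreasing and contracting: it keeps families of intervals
    free of overlaps and does not increase their total length. *)
Lemma abs_continuous_ac_line f a b : a <= b -> abs_continuous a b f ->
  ac_line (f \o clamp a b).
Proof.
move=> ab acf e /acf[d d0 H]; exists d => // l nl ld.
have := nonoverlapping_map (@clamp_homo a b) nl.
rewrite -total_increment_map.
have : total_length [seq (clamp a b p.1, clamp a b p.2) | p <- l] < d.
  exact: le_lt_trans (total_length_clamp a b nl) ld.
have : all (fun p => (a <= p.1) && (p.2 <= b))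
    [seq (clamp a b p.1, clamp a b p.2) | p <- l].
  by rewrite all_map; apply/allP => p _ /=; rewrite clamp_ge clamp_le.
move: (map _ _) => {nl ld} k kab kd /andP[k1 k2].
rewrite /total_increment (big_nth (0, 0)) big_mkord; apply/ltW.
apply: (H (size k) (fun i => (nth (0, 0) k i).1) (fun i => (nth (0, 0) k i).2)).
- move=> i ik; have ki := mem_nth (0, 0) ik.
  by have /andP[-> ->] := allP kab _ ki; rewrite (allP k1 _ ki).
- move=> i j /= ik jk [z []] /=; rewrite !in_itv/= => /andP[i1 i2] /andP[j1 j2].
  move/(pairwiseP (0, 0)) in k2.
  case: (ltngtP i j) => // ij.
  + have /orP[h|h] := k2 _ _ ik jk ij.
      by have := lt_trans (lt_le_trans i2 h) j1; rewrite ltxx.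
    by have := lt_trans (lt_le_trans j2 h) i1; rewrite ltxx.
  + have /orP[h|h] := k2 _ _ jk ik ij.
      by have := lt_trans (lt_le_trans j2 h) i1; rewrite ltxx.
    by have := lt_trans (lt_le_trans i2 h) j1; rewrite ltxx.
- by move: kd; rewrite /total_length (big_nth (0, 0)) big_mkord.
Qed.

Lemma ac_line_tv F : ac_line F -> forall e : R, 0 < e -> exists2 d : R, 0 < d &
  forall l, nonoverlapping l -> total_length l < d ->
    (\sum_(p <- l) total_variation p.1 p.2 F <= e%:E)%E.
Proof.
move=> acF e /acF[d d0 H]; exists d => // l nl ld.
have := @total_variation_family _ F d e H l [::] nl ld.
by rewrite /total_increment big_nil add0e.
Qed.

(** Intervals shorter than the [d] attached to e = 1 have variation at most 1,
    and finitely many of them cover [x, y]. *)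
Lemma ac_line_tv_fin F x y : ac_line F -> x <= y ->
  total_variation x y F \is a fin_num.
Proof.
move=> acF xy; have [d d0 H] := ac_line_tv acF ltr01.
have small u v : u <= v -> v - u < d -> total_variation u v F \is a fin_num.
  move=> uv uvd; rewrite ge0_fin_numE ?total_variation_ge0//.
  apply: le_lt_trans (ltry 1).
  have := H [:: (u, v)]; rewrite /nonoverlapping /total_length !big_seq1 /= uv.
  exact.
have [n] : exists n : nat, y - x < n%:R * (d / 2).
  exists (Num.bound ((y - x) / (d / 2))).
  by rewrite -ltr_pdivrMr ?divr_gt0// archi_boundP// divr_ge0// ?subr_ge0//; lra.
elim: n x xy => [|n ih] x xy; first by rewrite mul0r; lra.
move=> yx; have [yd|dy] := ltP (y - x) d; first exact: small.
rewrite (@total_variationD _ x y (x + d / 2)); [|lra|lra].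
rewrite fin_numD small ?ih//; try lra.
Qed.

Lemma ac_line_continuous F : ac_line F -> continuous F.
Proof.
move=> acF x; apply/cvgrPdist_le => e /acF[d d0 H].
near=> t.
have txd : `|x - t| < d by near: t; exact: cvgr_dist_lt.
have [xt|tx] := leP x t.
  have := H [:: (x, t)]; rewrite /nonoverlapping /total_length /total_increment.
  rewrite !big_seq1 /= xt distrC; apply => //.
  by move: txd; rewrite distrC ger0_norm// subr_ge0.
have := H [:: (t, x)]; rewrite /nonoverlapping /total_length /total_increment.
rewrite !big_seq1 /= (ltW tx); apply => //.
by move: txd; rewrite gtr0_norm// subr_gt0.
Unshelve. all: end_near. Qed.

(** Jordan decomposition: G is the variation V of F from a and H = V - F. Both
    are nondecreasing because an increment of F is bounded by that of V, and for
    the same reason the increments of H are at most twice those of V. *)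
Lemma ac_line_nondecreasing_sub F a b : a <= b -> ac_line F ->
  exists G H : R -> R, [/\ {homo G : x y / x <= y}, {homo H : x y / x <= y},
    ac_line G, ac_line H & F \o clamp a b = G \- H].
Proof.
move=> ab acF.
pose c := clamp a b.
pose V x := fine (total_variation a (c x) F).
have fin x y : c x <= c y -> total_variation (c x) (c y) F \is a fin_num.
  exact: ac_line_tv_fin.
have VD x y : x <= y -> V y - V x = fine (total_variation (c x) (c y) F).
  move=> xy; have cxy : c x <= c y by exact: clamp_homo.
  rewrite /V (total_variationD F (clamp_ge a b x) cxy) fineD.
  - by rewrite addrC addKr.
  - by apply: ac_line_tv_fin => //; exact: clamp_ge.
  - exact: fin.
have VF x y : x <= y -> `|F (c y) - F (c x)| <= V y - V x.
  move=> xy; have cxy : c x <= c y by exact: clamp_homo.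
  by rewrite VD// -lee_fin fineK ?fin// total_variation_ge.
have V0 x y : x <= y -> 0 <= V y - V x.
  by move=> /VF; apply: le_trans.
have acV : ac_line V.
  move=> e /(ac_line_tv acF)[d d0 H]; exists d => // l nl ld.
  have nl' := nonoverlapping_map (@clamp_homo a b) nl.
  have := H _ nl' (le_lt_trans (total_length_clamp a b nl) ld).
  rewrite big_map /= -lee_fin; apply: le_trans.
  rewrite /total_increment -sumEFin big_seq [leRHS]big_seq.
  apply: lee_sum => p pl; have p12 : p.1 <= p.2 by case/andP: nl => /allP ->.
  by rewrite ger0_norm ?V0// VD// fineK// fin// clamp_homo.
exists V, (fun x => V x - F (c x)); split => //.
- by move=> x y xy; rewrite -subr_ge0 V0.
- by move=> x y xy; have := VF _ _ xy; rewrite ler_norml; lra.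
- move=> e e0; have [|d d0 H] := acV (e / 2); first lra.
  exists d => // l nl ld; apply: (@le_trans _ _ (2 * total_increment V l)).
    rewrite /total_increment mulr_sumr big_seq [leRHS]big_seq.
    apply: ler_sum => p pl.
    have p12 : p.1 <= p.2 by case/andP: nl => /allP ->.
    have := VF _ _ p12; have := V0 _ _ p12.
    rewrite ler_norml => v0 /andP[? ?].
    by rewrite (ger0_norm v0) ler_norml; apply/andP; split; lra.
  by have := H l nl ld; lra.
- by apply/funext => x /=; rewrite opprB addrC subrK.
Qed.

End AbsolutelyContinuousOnTheLine.

(** * Stieltjes measures of absolutely continuous functions *)

Section StieltjesDomination.
Context {R : realType}.
Local Open Scope ereal_scope.
Notation mu := (@lebesgue_measure R).

Lemma open_interval_finite_measure (I : set R) :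
  open I -> is_interval I -> mu I < +oo ->
  exists p : R * R, I = `]p.1, p.2[%classic.
Proof.
move=> oI iI Ioo.
have [->|/set0P[z Iz]] := eqVneq I set0.
  by exists (0%R, 0%R) => /=; rewrite set_itvoo0.
have [lI uI] : has_lbound I /\ has_ubound I.
  have IE : I = [set` Rhull I] by exact/is_intervalP.
  have : mu [set` Rhull I] < +oo by rewrite -IE.
  have : z \in Rhull I by move: Iz; rewrite {1}IE.
  rewrite lebesgue_measure_itv [in has_lbound _]IE [in has_ubound _]IE.
  case E : (Rhull I) => [[b1 x|[|]] [b2 y|[|]]] //= zI loo;
    rewrite ?ltry ?ltNyr ?ltNyy//= in loo.
  by move: zI; rewrite in_itv/= andbF.
exists (inf I, sup I) => /=.
have := interval_bounded_interior iI lI uI.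
by rewrite (proj1 (interior_id I) oI) => {1}->; apply/seteqP; split => x /=;
  rewrite in_itv.
Qed.

Lemma stieltjes_ocitv (G : cumulative R R) (x y : R) : (x <= y)%R ->
  lebesgue_stieltjes_measure G `]x, y] = (G y - G x)%:E.
Proof.
move=> xy; rewrite /lebesgue_stieltjes_measure /measure_extension.
rewrite measurable_mu_extE/=; last exact: is_ocitv.
by rewrite wlength_itv_bnd.
Qed.

(** A null set A lies in an open U with mu U < d, a countable disjoint union of
    open intervals. Finitely many of these have total length below d, hence
    carry mass at most e by absolute continuity of G, and e is arbitrary. *)
Lemma stieltjes_dominated (G : cumulative R R) : ac_line G ->
  lebesgue_stieltjes_measure G `<< mu.
Proof.
move=> acG; apply/null_content_dominatesP => A mA A0.
pose nu : {measure set (measurableTypeR R) -> \bar R} :=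
  lebesgue_stieltjes_measure G.
apply/eqP; rewrite eq_le measure_ge0 andbT; apply/lee_addgt0Pr => e e0.
rewrite add0e; have [d d0 H] := acG e e0.
have [|U [oU AU UA]] := lebesgue_regularity_outer mA _ d0; first by rewrite A0.
have mU : measurable U by exact: open_measurable.
have Ud : mu U < d%:E.
  have : mu U <= mu (U `\` A) + mu A.
    apply: le_trans (measureU2 _ _ _) => //; last exact: measurableD.
    rewrite le_measure ?inE//; first by apply: measurableU => //; exact: measurableD.
    by move=> x Ux; have [Ax|Ax] := pselect (A x); [right|left].
  by move=> /le_lt_trans; apply; rewrite A0 adde0.
pose I := open_disjoint_itv oU.
have mI k : measurable (I k).
  by apply: open_measurable; exact: open_disjoint_itv_open.
have UI : U = \bigcup_k I k := open_disjoint_itv_bigcup oU.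
have tI : trivIset setT I := @open_disjoint_itv_trivIset _ _ oU.
have IU k : I k `<=` U by rewrite UI; exact: bigcup_sup.
have /choice[p pI] : forall k, exists p : R * R, I k = `]p.1, p.2[%classic.
  move=> k; apply: open_interval_finite_measure.
  - exact: open_disjoint_itv_open.
  - exact: open_disjoint_itv_is_interval.
  - apply: le_lt_trans (lt_trans Ud (ltry d)).
    by rewrite le_measure ?inE//; exact: mI.
have Iz k : ((p k).1 < (p k).2)%R = false -> I k = set0.
  by move=> h; rewrite pI set_itv_ge// bnd_simp h.
apply: (@le_trans _ _ (nu U)); first by rewrite le_measure ?inE.
rewrite UI measure_semi_bigcup//; last by rewrite -UI.
apply: lime_le; first by apply: is_cvg_nneseries => k _ _; exact: measure_ge0.
apply: nearW => N.
(* Empty components are dropped: their representation `]p.1, p.2[ need not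
   satisfy p.1 <= p.2, nor be apart from the other intervals. *)
pose l := [seq p k | k <- iota 0 N & ((p k).1 < (p k).2)%R].
have filt (m : set R -> \bar R) : m set0 = 0 ->
    \sum_(0 <= k < N) m (I k) =
    \sum_(k <- iota 0 N | ((p k).1 < (p k).2)%R) m (I k).
  move=> m0; rewrite /index_iota subn0 [RHS]big_mkcond/=.
  by apply: eq_bigr => k _; case: ifPn => // /negbTE/Iz ->.
have nl : nonoverlapping l.
  apply/andP; split.
    by apply/allP => _ /mapP[k + ->]; rewrite mem_filter => /andP[/ltW].
  rewrite pairwise_map.
  apply: (@sub_in_pairwise _ [pred k | ((p k).1 < (p k).2)%R] ltn).
  - move=> i j /=; rewrite !inE => pi pj ij; rewrite /itv_sep.
    rewrite leNgt [X in _ || X]leNgt -negb_and; apply/negP => /andP[h1 h2].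
    (* two overlapping open intervals share the midpoint of their overlap *)
    suff : i = j by move=> ijE; rewrite ijE ltnn in ij.
    apply: tI => //.
    exists ((Num.max (p i).1 (p j).1 + Num.min (p i).2 (p j).2) / 2)%R.
    rewrite !pI /= !in_itv/=.
    clear -pi pj h1 h2.
    by case: (leP (p i).1 (p j).1) => ?; case: (leP (p i).2 (p j).2) => ?;
      split; apply/andP; split; lra.
  - by apply/allP => k; rewrite mem_filter => /andP[].
  - apply: pairwise_filter; rewrite -sorted_pairwise ?iota_ltn_sorted//.
    exact: ltn_trans.
have ld : (total_length l < d)%R.
  rewrite -lte_fin; apply: le_lt_trans Ud.
  rewrite [in leRHS]UI measure_semi_bigcup//; last by rewrite -UI.
  apply: le_trans (@nneseries_lim_ge _ _ xpredT _ N _); last first.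
    by move=> *; exact: measure_ge0.
  rewrite filt ?measure0// /total_length big_map big_filter -sumEFin.
  apply: lee_sum => k pk; rewrite pI; move: pk.
  rewrite [leRHS](lebesgue_measure_itv `](p k).1, (p k).2[)/= lte_fin => ->.
  by rewrite EFinB.
apply: (@le_trans _ _ (total_increment G l)%:E); last by rewrite lee_fin H.
rewrite filt ?measure0// /total_increment big_map big_filter -sumEFin.
apply: lee_sum => k pk; rewrite ger0_norm; last first.
  by rewrite subr_ge0; apply: cumulative_is_nondecreasing; exact: ltW.
rewrite -stieltjes_ocitv ?(ltW pk)// le_measure ?inE//; first exact: mI.
by rewrite pI; exact: subset_itv_oo_oc.
Qed.

End StieltjesDomination.

(** * The fundamental theorem of calculus *)

Section FundamentalTheorem.
Context {R : realType}.
Notation mu := (@lebesgue_measure R).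

(** The Radon-Nikodym density of the Stieltjes measure of G, cut down to ]a, b]
    to make it finite. *)
Lemma ac_nondecreasing_density (G : R -> R) (a b : R) : a <= b ->
  {homo G : x y / x <= y} -> ac_line G ->
  exists g : R -> R, mu.-integrable setT (EFin \o g) /\
    forall x y, a <= x -> x <= y -> y <= b ->
      G y - G x = \int[mu]_(t in `]x, y]) g t.
Proof.
move=> ab ndG acG.
pose GC : cumulative R R := HB.pack_for (cumulative R R) G
  (isCumulative.Build R _ R G ndG (right_continuousW (ac_line_continuous acG))).
pose nu : {measure set (measurableTypeR R) -> \bar R} :=
  lebesgue_stieltjes_measure GC.
have nuE x y : x <= y -> nu `]x, y]%classic = (G y - G x)%:E.
  exact: (stieltjes_ocitv GC).
have mab : measurable (`]a, b]%classic : set (measurableTypeR R)) by [].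
have nuoo : (nu `]a, b]%classic < +oo)%E by rewrite nuE// ltry.
have dom : mfrestr mab nuoo `<< mu.
  apply/null_content_dominatesP => A mA A0.
  have /null_content_dominatesP nudom : nu `<< mu.
    exact: (stieltjes_dominated (G := GC) acG).
  apply: (@subset_measure0 _ _ _ nu (A `&` `]a, b]%classic) A) => //.
  - exact: measurableI.
  - by apply: nudom.
have [g [g0 gfin ig gE]] := radon_nikodym_sigma_finite dom.
exists (fine \o g); split.
  by apply: eq_integrable ig => // x _ /=; rewrite fineK.
move=> x y ax xy yb; rewrite /Rintegral.
have -> : (\int[mu]_(t in `]x, y]) ((fine \o g) t)%:E =
    \int[mu]_(t in `]x, y]) g t)%E.
  by apply: eq_integral => t _ /=; rewrite fineK.
rewrite -gE//; transitivity (fine (nu (`]x, y] `&` `]a, b]))) => //.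
rewrite setIidl ?nuE// => t /=; rewrite !in_itv/= => /andP[xt ty].
by rewrite (le_lt_trans ax)//= (le_trans ty).
Qed.

(** On [a, b], f differs by a constant from the indefinite integral of g = g1 - g2,
    where g1 and g2 are the densities of the two terms of the Jordan
    decomposition; this integral has derivative g at every Lebesgue point of g. *)
Theorem ac_fundamental_theorem (f : R -> R) (a b : R) : a < b ->
  abs_continuous a b f ->
  exists g : R -> R, [/\ mu.-integrable setT (EFin \o g),
    forall x y, a <= x -> x <= y -> y <= b ->
      f y - f x = \int[mu]_(t in `]x, y]) g t &
    {ae mu, forall x, a < x < b -> f^`()%classic x = g x}].
Proof.
move=> ab acf; have acF := abs_continuous_ac_line (ltW ab) acf.
have [G [H [ndG ndH acG acH GH]]] := ac_line_nondecreasing_sub (ltW ab) acF.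
have fGH x : a <= x -> x <= b -> f x = G x - H x.
  move=> ax xb; have := congr1 (fun h => h x) GH => /= <-.
  by rewrite !clamp_id ?ax ?xb.
have [g [ig gE]] := ac_nondecreasing_density (ltW ab) ndG acG.
have [h [ih hE]] := ac_nondecreasing_density (ltW ab) ndH acH.
have igh : mu.-integrable setT (EFin \o (fun x => g x - h x)).
  have := integrableB measurableT ig ih.
  by apply: eq_integrable => // x _ /=; rewrite EFinB.
have fE x y : a <= x -> x <= y -> y <= b ->
    f y - f x = \int[mu]_(t in `]x, y]) (g t - h t).
  move=> ax xy yb; rewrite RintegralB//; last 2 first.
  - exact: integrableS ig.
  - exact: integrableS ih.
  by rewrite -gE// -hE// !fGH//; [ring|exact: le_trans yb|exact: le_trans xy].
exists (fun x => g x - h x); split => //.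
have locgh : locally_integrable setT (fun x => g x - h x).
  apply: (open_integrable_locally openT); exact: igh.
have := lebesgue_differentiation locgh.
apply: filterS; first exact: (ae_filter_ringOfSetsType mu).
move=> x lx /andP[ax xb].
have iab : mu.-integrable [set` Interval (BRight a) (BRight b)]
    (EFin \o (fun x => g x - h x)) by exact: integrableS igh.
have [] := @FTC1_lebesgue_pt R (fun x => g x - h x) (BRight a) x b xb iab ax lx.
set F := (F in derivable F) => dF <-.
rewrite !derive1E.
have -> : 'D_1 f x = 'D_1 (cst (f a) + F) x.
  apply: near_eq_derive; near=> y.
  have ay : a <= y by apply: ltW; near: y; exact: lt_nbhsr.
  have yb : y <= b by apply: ltW; near: y; exact: lt_nbhsl.
  by rewrite fctE /F /= -fE// addrC subrK.
by rewrite deriveD// derive_cst add0r.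
Unshelve. all: end_near. Qed.

End FundamentalTheorem.

(** * The density function of a sigmoidal function *)

Section Convexity.
Context {R : realType}.

Lemma convex_function_conv (D : set R) (g : R -> R) (t x y : R) :
  @convex_function R R^o D g -> D x -> D y -> 0 <= t -> t <= 1 ->
  g (t * x + (1 - t) * y) <= t * g x + (1 - t) * g y.
Proof.
move=> cg Dx Dy t0 t1.
by have := cg (Itv01 t0 t1) x y (mem_set Dx) (mem_set Dy).
Qed.

(** The convexity inequality at an interior point y of [x, z], with the
    denominator z - x cleared so that it is linear in the values of g. *)
Lemma convex_three_points (D : set R) (g : R -> R) (x y z : R) :
  @convex_function R R^o D g -> D x -> D z -> x < y -> y < z ->
  (z - x) * g y <= (z - y) * g x + (y - x) * g z.
Proof.
move=> cg Dx Dz xy yz; have zx : 0 < z - x by lra.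
have t0 : 0 <= (z - y) / (z - x) by rewrite divr_ge0; lra.
have t1 : (z - y) / (z - x) <= 1 by rewrite ler_pdivrMr//; lra.
have := convex_function_conv cg Dx Dz t0 t1.
have -> : (z - y) / (z - x) * x + (1 - (z - y) / (z - x)) * z = y.
  by field; lra.
have -> : 1 - (z - y) / (z - x) = (y - x) / (z - x) by field; lra.
rewrite -(ler_pM2l zx) => /le_trans; apply.
by rewrite le_eqVlt; apply/orP; left; apply/eqP; field; lra.
Qed.

End Convexity.

Section Density.
Context {R : realType}.
Variable sigma : R -> R.
Hypothesis hsigma : admissible_sigmoidal sigma.

Lemma density_ge0 x : 0 <= density sigma x.
Proof.
rewrite /density mulr_ge0 ?invr_ge0// subr_ge0.
by apply: as_nondecreasing => //; lra.
Qed.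

Lemma densityN x : density sigma (- x) = density sigma x.
Proof.
rewrite /density; have h1 := as_odd hsigma (x - 1); have h2 := as_odd hsigma (x + 1).
have -> : - x + 1 = - (x - 1) by ring.
have -> : - x - 1 = - (x + 1) by ring.
lra.
Qed.

(** If the density vanished at y, the monotone sigma would be constant on
    [y - 1, y + 1]. This interval meets [0, 1], so the constant is at most
    sigma 1, and a concave function that is flat on an interval of [0, +oo[
    never exceeds its value there afterwards. Then the limit of sigma at +oo
    would be at most sigma 1 < 1. *)
Lemma density_gt0_nonneg y : 0 <= y -> y <= 2 -> 0 < density sigma y.
Proof.
move=> y0 y2; rewrite lt_neqAle density_ge0 andbT eq_sym; apply/eqP => dy.
have sE : sigma (y + 1) = sigma (y - 1) by move: dy; rewrite /density; lra.
pose p := Num.max (y - 1) 0.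
have [py p0 p1 pq] : [/\ y - 1 <= p, 0 <= p, p <= 1 & p < y + 1].
  by rewrite /p; case: (leP (y - 1) 0) => ?; split; lra.
have nd := as_nondecreasing hsigma.
have spq : sigma p = sigma (y + 1).
  apply/eqP; rewrite eq_le nd ?(ltW pq)//= sE nd//.
have ub z : y + 1 < z -> sigma z <= sigma 1.
  move=> yz; apply: (@le_trans _ _ (sigma p)); last exact: nd.
  have z0 : 0 <= z by lra.
  have := @convex_three_points R _ _ p (y + 1) z (as_concave hsigma).
  rewrite /= !in_itv/= !andbT => /(_ p0 z0 pq yz).
  rewrite -spq !mulrN => h.
  by rewrite -(ler_pM2l (_ : 0 < y + 1 - p)); lra.
have [_ _ s1] := as_sigmoidal hsigma.
suff : 1 <= sigma 1 by have := as_lt1 hsigma; lra.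
apply: (@cvgr_to_le _ _ _ _ _ _ _ s1); near=> z; apply: ub.
by near: z; apply: nbhs_pinfty_gt; exact: num_real.
Unshelve. all: end_near. Qed.

Lemma density_gt0 y : `|y| <= 2 -> 0 < density sigma y.
Proof.
have [y0|y0] := leP 0 y; rewrite ?(ger0_norm y0) ?(ltr0_norm y0) => y2.
  exact: density_gt0_nonneg.
by rewrite -densityN density_gt0_nonneg//; lra.
Qed.

Lemma density_support (Upsilon y : R) :
  closed_support (density sigma) `<=` `[- Upsilon, Upsilon] ->
  density sigma y != 0 -> `|y| <= Upsilon.
Proof.
move=> hs dy; have /hs : closed_support (density sigma) y by exact: subset_closure.
by rewrite /= in_itv/= ler_norml.
Qed.

End Density.

(** * The operator as a weighted mean of cell averages *)

Section KantorovichError.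
Context {R : realType}.
Notation mu := (@lebesgue_measure R).
Variable sigma : R -> R.
Hypothesis hsigma : admissible_sigmoidal sigma.
Variables (a b : R) (n : nat).
Hypothesis hn : Num.ceil (n%:R * a) <= Num.floor (n%:R * b) - 1.

Lemma node_range_gt0 : (0 < n%:R :> R).
Proof.
rewrite ltr0n lt0n; apply/eqP => n0; move: hn; rewrite n0 !mul0r.
by rewrite ceil0 floor0.
Qed.

Lemma finite_node_range : finite_set (node_range a b n).
Proof.
rewrite /node_range.
move: (Num.ceil (n%:R * a)) (Num.floor (n%:R * b) - 1) => p q.
apply: (@sub_finite_set _ _ ((fun i : nat => p + i%:Z) @` `I_(`|q - p|.+1)%N)).
  move=> k /= /andP[pk kq]; exists `|k - p|%N => /=; first by lia.
  by lia.
exact/finite_image/finite_II.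
Qed.

Lemma node_range_cell k : node_range a b n k ->
  a <= k%:~R / n%:R /\ (k + 1)%:~R / n%:R <= b.
Proof.
have n0 := node_range_gt0; move=> /= /andP[pk kq]; split.
  by rewrite ler_pdivlMr// mulrC (le_trans (ceil_ge _))// ler_int//.
by rewrite ler_pdivrMr// mulrC (le_trans _ (ge_floor _))// ler_int -lerBrDr.
Qed.

(** The nearest admissible node: the floor of n x when it is a node, otherwise an
    end of the range. The value 2 is forced at the right end, where the last node
    is floor (n b) - 1 while n x may be close to floor (n b) + 1. *)
Lemma node_range_near x : a <= x -> x <= b ->
  exists2 k, node_range a b n k & `|n%:R * x - k%:~R| <= 2.
Proof.
move=> ax xb; have n0 := node_range_gt0.
have nax : n%:R * a <= n%:R * x by rewrite ler_pM2l.
have nxb : n%:R * x <= n%:R * b by rewrite ler_pM2l.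
have [xp|px] := ltP (n%:R * x) (Num.ceil (n%:R * a))%:~R.
  exists (Num.ceil (n%:R * a)); first by rewrite /node_range/= lexx.
  have := ceil_itv (n%:R * a); rewrite intrB ler_norml => /andP[? ?].
  by apply/andP; split; lra.
have [qx|xq] := leP (Num.floor (n%:R * b))%:~R (n%:R * x).
  exists (Num.floor (n%:R * b) - 1); first by rewrite /node_range/= lexx andbT.
  have := floor_itv (n%:R * b); rewrite intrD intrB ler_norml => /andP[? ?].
  by apply/andP; split; lra.
exists (Num.floor (n%:R * x)).
  by rewrite /node_range/= floor_ge_int px/= lerBrDr lezD1 floor_lt_int.
have := floor_itv (n%:R * x); rewrite intrD ler_norml => /andP[? ?].
by apply/andP; split; lra.
Qed.

Lemma node_weights_gt0 x : a <= x -> x <= b ->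
  0 < \sum_(k \in node_range a b n) density sigma (n%:R * x - k%:~R).
Proof.
move=> ax xb; have [k hk kx] := node_range_near ax xb.
rewrite (fsbig_finite _ _ finite_node_range)/=.
rewrite (big_rem k)/=; last by rewrite in_fset_set ?inE//; exact: finite_node_range.
by rewrite ltr_pwDl ?density_gt0// sumr_ge0// => i _; exact: density_ge0.
Qed.

(** The weights are nonnegative with a positive sum, so the operator is a genuine
    weighted mean; only the cells with nonzero weight contribute to it. *)
Lemma kantorovich_error (f : R -> R) (B x : R) : a <= x -> x <= b ->
  (forall k, node_range a b n k -> density sigma (n%:R * x - k%:~R) != 0 ->
    `|n%:R * (\int[mu]_(u in `[k%:~R / n%:R, (k + 1)%:~R / n%:R]) f u) - f x|
      <= B) ->
  `|kantorovich sigma a b n f x - f x| <= B.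
Proof.
move=> ax xb H; have W0 := node_weights_gt0 ax xb.
rewrite /kantorovich; set W := \sum_(k \in _) density _ _ in W0 *.
(* f x is rewritten as f x * W / W, to be split over the nodes *)
rewrite -[X in _ - X](mulfK (lt0r_neq0 W0)) -mulrBl normrM normfV (gtr0_norm W0).
rewrite ler_pdivrMr// /W !(fsbig_finite _ _ finite_node_range)/=.
rewrite mulr_sumr -sumrB mulr_sumr; apply: le_trans (ler_norm_sum _ _ _) _.
rewrite big_seq [leRHS]big_seq; apply: ler_sum => k.
rewrite in_fset_set ?inE; last exact: finite_node_range.
move=> hk; rewrite -mulrBl normrM (ger0_norm (density_ge0 hsigma _)).
have [->|d0] := eqVneq (density sigma (n%:R * x - k%:~R)) 0; first by rewrite !mulr0.
by rewrite ler_wpM2r ?density_ge0// H.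
Qed.

End KantorovichError.

Section CellMean.
Context {R : realType}.
Notation mu := (@lebesgue_measure R).

Lemma mean_itv_error (f : R -> R) (c d y B : R) : c < d ->
  mu.-integrable `[c, d] (EFin \o f) ->
  (forall u, c <= u -> u <= d -> `|f u - y| <= B) ->
  `|(d - c)^-1 * (\int[mu]_(u in `[c, d]) f u) - y| <= B.
Proof.
move=> cd fi H.
have cdE : fine (mu `[c, d]) = d - c.
  by rewrite lebesgue_measure_itv/= lte_fin cd -EFinB.
have dc : 0 < d - c by lra.
have ic (r : R) : mu.-integrable `[c, d] (EFin \o cst r).
  apply: (@continuous_compact_integrable _ (cst r)).
    exact: segment_compact.
  by apply: continuous_subspaceT => x; exact: cvg_cst.
have cstE (r : R) : \int[mu]_(u in `[c, d]) (cst r u) = r * (d - c).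
  by rewrite Rintegral_cst// cdE.
have up : \int[mu]_(u in `[c, d]) f u <= (y + B) * (d - c).
  rewrite -cstE; apply: le_Rintegral => //.
  move=> u /=; rewrite in_itv/= => /andP[u1 u2].
  by have := H u u1 u2; rewrite ler_norml /=; lra.
have lo : (y - B) * (d - c) <= \int[mu]_(u in `[c, d]) f u.
  rewrite -cstE; apply: le_Rintegral => //.
  move=> u /=; rewrite in_itv/= => /andP[u1 u2].
  by have := H u u1 u2; rewrite ler_norml /=; lra.
rewrite mulrC ler_norml lerBrDr lerBlDr.
by rewrite ler_pdivlMr// ler_pdivrMr// addrC [B + y]addrC up lo.
Qed.

End CellMean.

(** * The pointwise error *)

Section PointwiseError.
Context {R : realType}.
Notation mu := (@lebesgue_measure R).

(** Integrals of nonnegative functions are suprema over simple functions, hence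
    monotone without appeal to measurability. It is applied to the error of the
    operator, whose measurability is never established. *)
Lemma le_integral_nonneg d (T : measurableType d) (m : {measure set T -> \bar R})
    (D : set T) (f g : T -> \bar R) :
  (forall x, D x -> 0 <= f x)%E -> (forall x, D x -> f x <= g x)%E ->
  (\int[m]_(x in D) f x <= \int[m]_(x in D) g x)%E.
Proof.
move=> f0 fg.
have g0 x : D x -> (0 <= g x)%E by move=> Dx; exact: le_trans (f0 x Dx) (fg x Dx).
rewrite !ge0_integralE//; apply: le_ereal_sup => _ /= [h hf <-]; exists h => //= x.
apply: le_trans (hf x) _; rewrite !patchE.
by case: ifPn => // /set_mem; exact: fg.
Qed.

Lemma le_Rintegral_subset (A B : set R) (h : R -> R) :
  measurable A -> measurable B -> A `<=` B -> (forall t, 0 <= h t) ->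
  mu.-integrable B (EFin \o h) ->
  \int[mu]_(t in A) h t <= \int[mu]_(t in B) h t.
Proof.
move=> mA mB AB h0 ih.
have iA : mu.-integrable A (EFin \o h) by exact: integrableS ih.
rewrite /Rintegral fine_le//; [exact: integrable_fin_num|exact: integrable_fin_num|].
apply: ge0_subset_integral => //; first by case/integrableP : ih.
by move=> x _; rewrite lee_fin.
Qed.

Lemma abs_continuous_integrable (f : R -> R) (a b c d : R) :
  a <= b -> abs_continuous a b f -> a <= c -> d <= b ->
  mu.-integrable `[c, d] (EFin \o f).
Proof.
move=> ab acf ac db.
have cf : continuous (f \o clamp a b).
  exact/ac_line_continuous/abs_continuous_ac_line.
have := @continuous_compact_integrable R (f \o clamp a b) `[c, d]
  (@segment_compact _ _ _) (continuous_subspaceT cf).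
apply: eq_integrable => // x; rewrite inE/= in_itv/= => /andP[cx xd].
by rewrite clamp_id// (le_trans ac)//= (le_trans xd).
Qed.

Variables (f g : R -> R) (a b : R).
Hypothesis ab : a < b.
Hypothesis acf : abs_continuous a b f.
Hypothesis ig : mu.-integrable setT (EFin \o g).
Hypothesis fg : forall x y, a <= x -> x <= y -> y <= b ->
  f y - f x = \int[mu]_(t in `]x, y]) g t.

(* |g| on [a, b], extended by 0: windows around points of [a, b] may then stick
   out of [a, b]. *)
Let G := (Num.norm \o g) \_ `[a, b].

Lemma restrict_norm_ge0 t : 0 <= G t.
Proof. by rewrite /G patchE; case: ifP => _ /=. Qed.

Lemma integrable_restrict_norm : mu.-integrable setT (EFin \o G).
Proof.
have iab : mu.-integrable `[a, b] (EFin \o g) by exact: integrableS ig.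
rewrite /G -restrict_EFin -integrable_mkcond//.
by have := integrable_abse iab; exact: eq_integrable.
Qed.

Lemma increment_le_integral x u c d : a <= x -> x <= b -> a <= u -> u <= b ->
  c <= x -> x <= d -> c <= u -> u <= d ->
  `|f u - f x| <= \int[mu]_(t in `[c, d]) G t.
Proof.
wlog xu : x u / x <= u.
  move=> H; have [xu|/ltW ux] := leP x u; first exact: H.
  by move=> *; rewrite distrC; exact: H.
move=> ax _ _ ub cx _ _ ud; rewrite fg//.
have igxu : mu.-integrable `]x, u] (EFin \o g) by exact: integrableS ig.
apply: le_trans (le_normr_Rintegral _ igxu) _; first exact: measurable_itv.
have -> : \int[mu]_(t in `]x, u]) `|g t| = \int[mu]_(t in `]x, u]) G t.
  apply: eq_Rintegral => t; rewrite inE/= in_itv/= => /andP[xt tu].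
  rewrite /G patchE mem_set//= in_itv/= (le_trans ax (ltW xt))/=.
  exact: le_trans ub.
apply: le_Rintegral_subset => //; [|exact: restrict_norm_ge0|].
  move=> t /=; rewrite !in_itv/= => /andP[xt tu].
  by rewrite (le_trans cx (ltW xt)) (le_trans tu).
exact: integrableS integrable_restrict_norm.
Qed.

(** For u in the cell [k / n, (k + 1) / n] of a node with nonzero weight,
    |n u - k| <= 1 and |n x - k| <= Upsilon, so |u - x| <= (1 + Upsilon) / n. *)
Lemma kantorovich_pointwise (sigma : R -> R) (Upsilon : R) (n : nat) (x : R) :
  admissible_sigmoidal sigma ->
  closed_support (density sigma) `<=` `[- Upsilon, Upsilon] ->
  Num.ceil (n%:R * a) <= Num.floor (n%:R * b) - 1 ->
  a <= x -> x <= b ->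
  `|kantorovich sigma a b n f x - f x| <=
  \int[mu]_(t in `[x - (1 + Upsilon) / n%:R, x + (1 + Upsilon) / n%:R]) G t.
Proof.
move=> hs hsupp hn ax xb; have n0 := node_range_gt0 hn.
set r := (1 + Upsilon) / n%:R.
apply: kantorovich_error => // k hk dk.
have kx := density_support hsupp dk.
have [ak kb] := node_range_cell hn hk.
have kE : (k + 1)%:~R / n%:R - k%:~R / n%:R = n%:R^-1 :> R.
  by rewrite -mulrBl intrD addrAC subrr add0r mul1r.
have n1 : 0 < n%:R^-1 :> R by rewrite invr_gt0.
(* n is the inverse of the length of a cell *)
rewrite -[X in X * _]invrK -[in X in X^-1]kE.
apply: mean_itv_error; first lra.
  exact: (abs_continuous_integrable (ltW ab) acf).
move=> u ku uk.
have U0 : 0 <= Upsilon by rewrite (le_trans _ kx).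
have r0 : 0 <= r by rewrite divr_ge0// ?addr_ge0// ltW.
have ux : `|u - x| <= r.
  rewrite /r ler_pdivlMr// -[X in _ * X]gtr0_norm// -normrM.
  move: ku uk kx; rewrite ler_pdivrMr// ler_pdivlMr// intrD => ku uk.
  rewrite !ler_norml => /andP[k1 k2]; apply/andP; split; nra.
move: ux; rewrite ler_norml => /andP[u1 u2].
by apply: increment_le_integral; lra.
Qed.

End PointwiseError.

(** * Jensen's inequality for N-functions *)

Section Jensen.
Context {R : realType}.
Notation mu := (@lebesgue_measure R).
Variable phi : R -> R.
Hypothesis hphi : N_function phi.

Let nd := phi_nondecreasing (N_phi_function hphi).

Lemma phi_le x y : 0 <= x -> x <= y -> phi x <= phi y.
Proof.
by move=> x0 xy; apply: nd => //; rewrite in_itv/= andbT//; exact: le_trans xy.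
Qed.

Lemma phi_ge0 x : 0 <= x -> 0 <= phi x.
Proof. by move=> x0; rewrite -(phi_at0 (N_phi_function hphi)) phi_le. Qed.

(** Only the values of phi on [0, +oo[ are constrained; phi (max 0 x) is a
    nondecreasing function on the line with the same values there. *)
Lemma measurable_phi_norm (D : set R) (h : R -> R) : measurable_fun D h ->
  measurable_fun D (fun x => phi `|h x|).
Proof.
move=> mh.
have mphi : measurable_fun [set: R] (fun x : R => phi (Num.max 0 x)).
  apply: nondecreasing_measurable => // x y xy; apply: phi_le.
    by rewrite le_max lexx.
  by rewrite ge_max !le_max lexx xy orbT.
rewrite (_ : (fun x => phi `|h x|) =
    (fun x => phi (Num.max 0 x)) \o (Num.norm \o h)).
  by apply: measurableT_comp => //; exact: measurableT_comp.
by apply/funext => x /=; rewrite max_r.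
Qed.

(** The slope is the supremum of the slopes of the chords ending at m, which are
    bounded by those of the chords starting at m. There are no chords ending at
    m = 0, where the slope 0 works since phi is nonnegative and phi 0 = 0. *)
Lemma supporting_line m : 0 <= m ->
  exists c : R, forall t, 0 <= t -> phi m + c * (t - m) <= phi t.
Proof.
rewrite le_eqVlt => /predU1P[<-|m0].
  by exists 0 => t t0; rewrite mul0r addr0 phi_le.
pose S := [set s | exists2 t, 0 <= t < m & s = (phi m - phi t) / (m - t)].
have S0 : S !=set0 by exists ((phi m - phi 0) / (m - 0)), 0 => //; rewrite lexx.
have slope t s : 0 <= t -> t < m -> m < s ->
    (phi m - phi t) / (m - t) <= (phi s - phi m) / (s - m).
  move=> t0 tm ms; have mt0 : 0 < m - t by lra.
  have sm0 : 0 < s - m by lra.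
  rewrite ler_pdivrMr// mulrAC ler_pdivlMr//.
  have := @convex_three_points R _ _ t m s (N_convex hphi).
  rewrite /= !in_itv/= !andbT => /(_ t0 (ltW (lt_trans m0 ms)) tm ms); lra.
have Sub s : m < s -> ubound S ((phi s - phi m) / (s - m)).
  by move=> ms _ [t /andP[t0 tm] ->]; exact: slope.
exists (sup S) => t t0; have [tm|mt|<-] := ltgtP t m.
- have : (phi m - phi t) / (m - t) <= sup S.
    apply: ub_le_sup; last by exists t => //; rewrite t0.
    by exists ((phi (m + 1) - phi m) / (m + 1 - m)); apply: Sub; lra.
  by rewrite ler_pdivrMr ?subr_gt0//; lra.
- have : sup S <= (phi t - phi m) / (t - m) by apply: ge_sup => //; exact: Sub.
  by rewrite ler_pdivlMr ?subr_gt0//; lra.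
- by rewrite subrr mulr0 addr0.
Qed.

(** Integrate the supporting line of phi at the average A of |h|: the linear term
    vanishes. If phi o |h| is not integrable the right-hand side is +oo. *)
Lemma jensen_N_function (D : set (measurableTypeR R)) (m : R) (h : R -> R) :
  measurable D -> 0 < m -> mu D = m%:E -> mu.-integrable D (EFin \o h) ->
  ((phi (m^-1 * \int[mu]_(x in D) `|h x|))%:E <=
   m^-1%:E * \int[mu]_(x in D) (phi `|h x|)%:E)%E.
Proof.
move=> mD m0 muD ih.
have mh : measurable_fun D h by case/integrableP : ih => /measurable_EFinP.
have inorm : mu.-integrable D (EFin \o (fun x => `|h x|)).
  by have := integrable_abse ih; exact: eq_integrable.
have mphi := measurable_phi_norm mh.
have phi0 x : 0 <= phi `|h x| by exact: phi_ge0.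
have [yes|no] := boolP (\int[mu]_(x in D) (phi `|h x|)%:E < +oo)%E; last first.
  move: no; rewrite -leNgt leye_eq => /eqP ->.
  by rewrite gt0_muley ?leey// lte_fin invr_gt0.
have iphi : mu.-integrable D (EFin \o (fun x => phi `|h x|)).
  apply/integrableP; split; first exact/measurable_EFinP.
  apply: le_lt_trans yes.
  by apply: le_integral_nonneg => // x _ /=; rewrite ger0_norm.
set A := m^-1 * _.
have A0 : 0 <= A.
  by apply: mulr_ge0; [rewrite invr_ge0 ltW|exact: Rintegral_ge0].
have [c hc] := supporting_line A0.
have icst r : mu.-integrable D (EFin \o cst r).
  apply: measurable_bounded_integrable => //.
    by move: muD => /= ->; rewrite ltry.
  by exists `|r|; split; rewrite ?num_real// => s rs x _ /=; exact: ltW.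
have fmuD : fine (mu D) = m by rewrite muD.
have cstE r : \int[mu]_(x in D) (cst r x) = r * m.
  by rewrite Rintegral_cst//; congr (_ * _); exact: fmuD.
rewrite -[X in (_ * X)%E]fineK ?(integrable_fin_num _ iphi)//.
rewrite -EFinM lee_fin -ler_pdivrMl ?invr_gt0// invrK.
have ic1 : mu.-integrable D (EFin \o (fun x => c * `|h x|)).
  by have := integrableZl mD c inorm; exact: eq_integrable.
have idx : mu.-integrable D (EFin \o (fun x => cst (phi A - c * A) x + c * `|h x|)).
  by have := integrableD mD (icst (phi A - c * A)) ic1; exact: eq_integrable.
apply: (@le_trans _ _ (\int[mu]_(x in D) (cst (phi A - c * A) x + c * `|h x|))).
  rewrite RintegralD// cstE RintegralZl//.
  have -> : \int[mu]_(x in D) `|h x| = m * A by rewrite /A mulVKf// lt0r_neq0.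
  by rewrite le_eqVlt; apply/orP; left; apply/eqP; ring.
apply: le_Rintegral => // x _ /=; have := hc `|h x| (normr_ge0 _); lra.
Qed.

End Jensen.

(** * Averaging over a sliding window *)

Section WindowAverage.
Context {R : realType}.
Notation mu := (@lebesgue_measure R).
Local Open Scope ereal_scope.

(** Tonelli: t lies in the window of x exactly when x lies in the window of t,
    and the latter has length 2 r. *)
Lemma integral_window (P : R -> R) (r : R) : (0 < r)%R ->
  measurable_fun setT P -> (forall t, (0 <= P t)%R) ->
  \int[mu]_x \int[mu]_(t in `[(x - r)%R, (x + r)%R]) (P t)%:E =
  (2 * r)%:E * \int[mu]_t (P t)%:E.
Proof.
move=> r0 mP P0.
pose B : set (measurableTypeR R * measurableTypeR R) :=
  [set z | (`|z.2 - z.1| <= r)%R].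
pose F (z : measurableTypeR R * measurableTypeR R) := (P z.2 * \1_B z)%:E.
have mB : measurable B.
  rewrite (_ : B = (fun z => `|z.2 - z.1|%R) @^-1` `]-oo, r]); last first.
    by apply/seteqP; split => z /=; rewrite in_itv.
  rewrite -[X in measurable X]setTI.
  have mh : measurable_fun [set: measurableTypeR R * measurableTypeR R]
      (fun z => `|z.2 - z.1|%R).
    by apply: measurableT_comp => //; exact: measurable_funB.
  by apply: mh => //; exact: measurable_itv.
have mF : measurable_fun setT F.
  apply/measurable_EFinP; apply: measurable_funM; last exact: measurable_indic.
  exact: measurableT_comp.
have F0 z : 0 <= F z by rewrite lee_fin mulr_ge0.
have inB x t : ((x, t) \in B) = (t \in `[(x - r)%R, (x + r)%R]).
  rewrite in_itv/= -ler_distlC distrC; apply/idP/idP => [/set_mem//|h].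
  exact: mem_set.
transitivity (\int[mu]_x \int[mu]_t F (x, t)).
  apply: eq_integral => x _; rewrite integral_mkcond; apply: eq_integral => t _.
  rewrite patchE /F /= indicE inB mem_setE.
  by case: ifP => _; rewrite ?mulr1 ?mulr0.
rewrite (@fubini_tonelli _ _ _ _ _ mu mu F mF F0).
transitivity (\int[mu]_t ((P t)%:E * (2 * r)%:E)).
  apply: eq_integral => t _.
  transitivity (\int[mu]_(x in `[(t - r)%R, (t + r)%R]) cst (P t)%:E x).
    rewrite [RHS]integral_mkcond; apply: eq_integral => x _.
    rewrite patchE /F /= indicE inB mem_setE !in_itv/=.
    have -> : ((x - r <= t <= x + r) = (t - r <= x <= t + r))%R.
      by apply/idP/idP => /andP[? ?]; apply/andP; split; lra.
    by case: ifP => _; rewrite ?mulr1 ?mulr0.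
  rewrite integral_cst//.
  rewrite [X in _ * X](lebesgue_measure_itv `[(t - r)%R, (t + r)%R])/=.
  rewrite lte_fin ifT; last lra.
  by rewrite -EFinB; congr (_ * _%:E); lra.
rewrite ge0_integralZr//; first by rewrite muleC.
- exact/measurable_EFinP.
- by move=> t _; rewrite lee_fin.
- by rewrite lee_fin; lra.
Qed.

End WindowAverage.

(** * From the pointwise error to the modular *)

Section ModularError.
Context {R : realType}.
Notation mu := (@lebesgue_measure R).
Variables (phi f g : R -> R) (a b : R).
Hypothesis hphi : N_function phi.
Hypothesis mf' : measurable_fun `[a, b] f^`()%classic.
Hypothesis ig : mu.-integrable setT (EFin \o g).
Hypothesis f'g : {ae mu, forall x, a < x < b -> f^`()%classic x = g x}.

Let G := (Num.norm \o g) \_ `[a, b].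

(** f' and g agree almost everywhere only on the open interval; the endpoints of
    [a, b] form a null set, and phi 0 = 0 discards the complement of [a, b]. *)
Lemma modular_derivative (u : R) :
  (\int[mu]_t (phi `|G t / u|)%:E =
   modular phi a b (fun x => (f^`()%classic x / u)%R))%E.
Proof.
have mg : measurable_fun setT g by case/integrableP : ig => /measurable_EFinP.
have mgab : measurable_fun `[a, b] g by exact: measurable_funS mg.
transitivity (\int[mu]_(t in `[a, b]) (phi `|g t / u|)%:E)%E.
  rewrite [RHS]integral_mkcond; apply: eq_integral => t _.
  rewrite /G !patchE; case: ifP => _ /=.
    by rewrite !normrM normr_id.
  by rewrite mul0r normr0 (phi_at0 (N_phi_function hphi)).
have mphi (k : R -> R) : measurable_fun `[a, b] k ->
    measurable_fun `]a, b[ (fun t => (phi `|k t / u|)%:E).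
  move=> mk; have mku : measurable_fun `[a, b] (fun t => k t / u).
    exact: measurable_funM.
  have := measurable_phi_norm hphi mku => /measurable_EFinP.
  by apply: measurable_funS => //; exact: subset_itv_oo_cc.
rewrite /modular (integral_itv_bndoo _ _ (mphi _ mgab)).
rewrite (integral_itv_bndoo _ _ (mphi _ mf')).
apply: ge0_ae_eq_integral => //; [exact: mphi|exact: mphi|..].
- by move=> x _; rewrite lee_fin phi_ge0.
- by move=> x _; rewrite lee_fin phi_ge0.
- move: f'g; apply: filterS; first exact: (ae_filter_ringOfSetsType mu).
  by move=> x h /=; rewrite in_itv/= => /h ->.
Qed.

(** |h| / (2 r u) is at most the average of G / u over a window of length 2 r.
    Jensen's inequality bounds phi of it by the average of phi (G / u), and the
    integral of this average over all windows is that of phi (G / u). *)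
Lemma modular_le_window (h : R -> R) (r u : R) : 0 < r -> 0 < u ->
  (forall x, a <= x -> x <= b -> `|h x| <= \int[mu]_(t in `[x - r, x + r]) G t) ->
  (modular phi a b (fun x => (h x / (2 * r * u))%R) <=
   modular phi a b (fun x => (f^`()%classic x / u)%R))%E.
Proof.
move=> r0 u0 hG; rewrite -modular_derivative.
have iG : mu.-integrable setT (EFin \o G) := integrable_restrict_norm a b ig.
have G0 t : 0 <= G t by exact: restrict_norm_ge0.
have mG : measurable_fun setT G by case/integrableP : iG => /measurable_EFinP.
have mGu : measurable_fun setT (fun t => phi `|G t / u|).
  by apply: (measurable_phi_norm hphi); exact: measurable_funM.
have r20 : 0 < 2 * r by lra.
have phiG0 t : 0 <= phi `|G t / u| by exact: phi_ge0.
(* the factor 1 / (2 r) is kept under the integral sign, so that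
   [integral_window] applies to [P] directly *)
pose P t := (2 * r)^-1 * phi `|G t / u|.
have P0 t : 0 <= P t by rewrite mulr_ge0 ?invr_ge0 ?(ltW r20).
have mP : measurable_fun setT P by exact: measurable_funM.
pose W x := (\int[mu]_(t in `[(x - r)%R, (x + r)%R]) (P t)%:E)%E.
have W0 x : (0 <= W x)%E by apply: integral_ge0 => t _; rewrite lee_fin.
have pw x : a <= x -> x <= b -> ((phi `|h x / (2 * r * u)|)%:E <= W x)%E.
  move=> ax xb.
  have ix : mu.-integrable `[x - r, x + r] (EFin \o G) by exact: integrableS iG.
  have ixu : mu.-integrable `[x - r, x + r] (EFin \o (fun t => G t / u)).
    have mx : measurable (`[x - r, x + r]%classic : set (measurableTypeR R)) by [].
    have := integrableZl mx u^-1 ix.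
    by apply: eq_integrable => // t _ /=; rewrite muleC.
  have mux : mu `[x - r, x + r]%classic = (2 * r)%:E.
    rewrite lebesgue_measure_itv/= lte_fin ifT; last lra.
    by rewrite -EFinB; congr (_%:E); lra.
  have -> : W x = ((2 * r)^-1%:E *
      \int[mu]_(t in `[(x - r)%R, (x + r)%R]) (phi `|G t / u|)%:E)%E.
    rewrite /W -ge0_integralZl//.
    - exact/measurable_EFinP/measurable_funTS.
    - by move=> t _; rewrite lee_fin.
    - by rewrite lee_fin invr_ge0 (ltW r20).
  apply: le_trans (jensen_N_function hphi (measurable_itv _) r20 mux ixu).
  rewrite lee_fin (phi_le hphi)//.
  have -> : \int[mu]_(t in `[x - r, x + r]) `|G t / u| =
      (\int[mu]_(t in `[x - r, x + r]) G t) / u.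
    rewrite -RintegralZr//; apply: eq_Rintegral => t _.
    by rewrite ger0_norm// divr_ge0// ltW.
  rewrite normrM normfV (gtr0_norm (mulr_gt0 r20 u0)).
  rewrite invfM mulrCA ler_pM2l ?invr_gt0// ler_pM2r ?invr_gt0//.
  exact: hG.
rewrite /modular.
apply: (@le_trans _ _ (\int[mu]_(x in `[a, b]) W x)%E).
  apply: le_integral_nonneg => x /=; first by rewrite lee_fin phi_ge0.
  by rewrite in_itv/= => /andP[ax xb]; exact: pw.
apply: (@le_trans _ _ (\int[mu]_x W x)%E).
  rewrite integral_mkcond; apply: le_integral_nonneg => x _;
    by rewrite patchE; case: ifP.
rewrite /W integral_window// -ge0_integralZl//; first last.
- by rewrite lee_fin (ltW r20).
- by move=> t _; rewrite lee_fin.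
- exact/measurable_EFinP.
by apply: le_integral_nonneg => t _; rewrite -EFinM lee_fin /P mulVKf ?lt0r_neq0.
Qed.

End ModularError.

(** * The approximation theorem *)

Theorem theorem4p2 (R : realType) (a b : R) (hab : a < b)
    (phi : R -> R) (hphi : N_function phi)
    (sigma : R -> R) (hsigma : admissible_sigmoidal sigma)
    (Upsilon : R) (hUpsilon : 0 < Upsilon)
    (hcompact : compact (closed_support (density sigma)))
    (hsupport : closed_support (density sigma) `<=` `[- Upsilon, Upsilon])
    (f : R -> R) (hf : sobolev_orlicz phi a b f)
    (n : nat) (hn : Num.ceil (n%:R * a) <= Num.floor (n%:R * b) - 1) :
  (luxemburg phi a b (fun x => (kantorovich sigma a b n f x - f x)%R)
   <= (4 * (1 + Upsilon))%:E * (luxemburg phi a b f^`()%classic * (n%:R^-1)%:E))%E.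
Proof.
have [acf [mf' _]] := hf.
have [g [ig fE f'g]] := ac_fundamental_theorem hab acf.
have n0 := node_range_gt0 hn.
pose r := (1 + Upsilon) / n%:R.
have r0 : 0 < r by rewrite divr_gt0//; lra.
have r20 : 0 < 2 * r by lra.
(* every u admissible for f' makes 2 r u admissible for the error *)
have key u : 0 < u -> (modular phi a b (fun x => (f^`()%classic x / u)%R) <= 1)%E ->
    (luxemburg phi a b (fun x => (kantorovich sigma a b n f x - f x)%R)
      <= (2 * r * u)%:E)%E.
  move=> u0 hu; apply: ereal_inf_lbound; exists (2 * r * u) => //=; split.
    exact: mulr_gt0.
  apply: le_trans hu; apply: (modular_le_window hphi mf' ig f'g r0 u0).
  by move=> x ax xb; exact: kantorovich_pointwise.
have L0 : (0 <= luxemburg phi a b f^`()%classic)%E.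
  by apply: le_ereal_inf_tmp => _ [u [u0 _] <-]; rewrite lee_fin ltW.
apply: (@le_trans _ _ ((2 * r)%:E * luxemburg phi a b f^`()%classic)%E).
  rewrite -lee_pdivrMl //; apply: le_ereal_inf_tmp => _ [u [u0 hu] <-].
  by rewrite lee_pdivrMl// -EFinM; exact: key.
rewrite (muleC (luxemburg _ _ _ _)) muleA -EFinM; apply: lee_wpmul2r => //.
rewrite lee_fin /r !mulrA ler_pM2r ?invr_gt0//; lra.
Qed.
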